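(* Fix $\alpha,\beta\in[0,1)$ with $\alpha+\beta<1$. For each $n$ let $k=k_n$, $l=l_n$ be integers with $\liminf_{n\to\infty} l_n/n>\beta$ and $\limsup_{n\to\infty}(k_n+l_n)/n<1-\alpha$, i.e. the code rates $R_0=l/n$, $R_1=k/n$ eventually satisfy $R_0>\beta$ and $R_0+R_1<1-\alpha$ with margins bounded away from $0$. Let $\widetilde G=[G_1\ G_0]$ be an $n\times(k+l)$ binary matrix with i.i.d. uniform entries ($G_1$ its first $k$ columns, $G_0$ its last $l$ columns), and let $\mathbf m\in\{0,1\}^k$ be arbitrary. Then, for the binary defect and erasure channel with the encoding and decoding described in the context, the probability of recovery failure $P(\widehat{\mathbf m}\neq\mathbf m)$ tends to $0$ as $n\to\infty$.
   Context: All arithmetic is over $\mathrm{GF}(2)$. Binary defect and erasure channel (BDEC) with parameters $(\beta,\alpha)$: each of the $n$ cells is independently defective with probability $\beta$; a defective cell is stuck at $0$ or $1$, each with probability $1/2$, independently. Writing codeword $\mathbf c$ stores $\mathbf c\circ\mathbf s$, where $(\mathbf c\circ\mathbf s)_i=s_i$ if cell $i$ is defective with stuck-at value $s_i$ and $=c_i$ otherwise. Then each of the $n$ stored bits is independently erased with probability $\alpha$ (independently of everything else); $\mathcal V$ is the set of unerased positions and the decoder observes $\mathcal V$ and $\mathbf y^{\mathcal V}=(\mathbf c\circ\mathbf s)^{\mathcal V}$. For a matrix/vector, superscript $\mathcal A$ denotes the rows indexed by the set $\mathcal A$. Encoding: with $\mathcal U$ the set of defects and $\mathbf b^{\mathcal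 U}=(G_1\mathbf m)^{\mathcal U}+\mathbf s^{\mathcal U}$, find $\mathbf d\in\{0,1\}^l$ with $G_0^{\mathcal U}\mathbf d=\mathbf b^{\mathcal U}$ and write $\mathbf c=G_1\mathbf m+G_0\mathbf d$; encoding failure ($E=0$) if no such $\mathbf d$ exists. Decoding: solve $\widetilde G^{\mathcal V}\binom{\widehat{\mathbf m}}{\widehat{\mathbf d}}=\mathbf y^{\mathcal V}$. The event $\{\widehat{\mathbf m}\neq\mathbf m\}$ (recovery failure) is declared if encoding fails, or if the solution set of this linear system contains vectors with different message parts $\widehat{\mathbf m}$, or does not contain $(\mathbf m,\mathbf d)$. *)

(* Defs.v *)
From HB Require Import structures.
From mathcomp Require Import all_boot all_order all_algebra.
Set Implicit Arguments. Unset Strict Implicit. Unset Printing Implicit Defensive.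
Import Order.TTheory GRing.Theory Num.Theory.
Local Open Scope ring_scope.

Definition encode_d (n k l : nat) (G : 'M['F_2]_(n, k + l)) (U : {set 'I_n})
  (s : 'cV['F_2]_n) (m : 'cV['F_2]_k) : option 'cV['F_2]_l :=
  [pick d : 'cV['F_2]_l |
     [forall i in U, (rsubmx G *m d) i 0 == (lsubmx G *m m + s) i 0]].

Definition recovery_failure (n k l : nat) (G : 'M['F_2]_(n, k + l))
  (U : {set 'I_n}) (s : 'cV['F_2]_n) (V : {set 'I_n}) (m : 'cV['F_2]_k) : bool :=
  match encode_d G U s m with
  | None => true
  | Some d =>
      let c := lsubmx G *m m + rsubmx G *m d in
      let y := \col_i (if i \in U then s i 0 else c i 0) in
      let sol (x : 'cV['F_2]_(k + l)) := [forall i in V, (G *m x) i 0 == y i 0] in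
      [exists x1 : 'cV['F_2]_(k + l), exists x2 : 'cV['F_2]_(k + l),
         [&& sol x1, sol x2 & usubmx x1 != usubmx x2]]
      || ~~ sol (col_mx m d)
  end.

(* P(m_hat <> m): G uniform, U = defect set (each cell independently w.p. beta),
   s uniform stuck-at values (only coordinates in U matter), V = unerased set
   (each cell independently unerased w.p. 1 - alpha). *)
Definition fail_prob (R : numFieldType) (alpha beta : R) (n k l : nat)
  (m : 'cV['F_2]_k) : R :=
  \sum_(G : 'M['F_2]_(n, k + l)) \sum_(U : {set 'I_n})
  \sum_(s : 'cV['F_2]_n) \sum_(V : {set 'I_n})
    ((2%:R)^-1 ^+ (n * (k + l)) * (beta ^+ #|U| * (1 - beta) ^+ (n - #|U|))
     * (2%:R)^-1 ^+ n * ((1 - alpha) ^+ #|V| * alpha ^+ (n - #|V|)))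
    * (recovery_failure G U s V m)%:R.
Arguments fail_prob {R} alpha beta n k l m.

(* Main.v *)
(* Encoding can fail only if G_0 has a nonzero left-kernel vector supported on the
   defect set U, and decoding is ambiguous only if the unerased rows of G have a
   nonzero kernel vector; (m, d) itself always solves the decoding system.  By a
   union bound these events have conditional probability at most 2^(|U| - l) and
   2^(k + l - |V|) = 2^(|W| - (n - k - l)), where W is the set of erasures.  Since
   |U| and |W| are binomial with means n beta and n alpha, at distance at least
   n delta below l and n - k - l, Chebyshev's inequality bounds both expectations
   by C / n. *)
Require Import Defs.
From HB Require Import structures.
From mathcomp Require Import all_boot all_order all_algebra.
From mathcomp Require Import zify ring lra.
Set Implicit Arguments.
Unset Strict Implicit. Unset Printing Implicit Defensive.
Import Order.TTheory GRing.Theory Num.Theory.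
Local Open Scope ring_scope.

(** * Random subsets and binomial moments *)

Lemma sum_set_card (V : nmodType) (n : nat) (F : nat -> V) :
  \sum_(A : {set 'I_n}) F #|A| = \sum_(i < n.+1) F i *+ 'C(n, i).
Proof.
rewrite (partition_big (fun A : {set 'I_n} => inord #|A| : 'I_n.+1) xpredT) //=.
apply: eq_bigr => i _.
have cardE (A : {set 'I_n}) : (inord #|A| == i) = (#|A| == i :> nat).
  by rewrite -val_eqE /= inordK // ltnS -[leqRHS]card_ord max_card.
rewrite (eq_bigl _ _ cardE) (eq_bigr (fun=> F i)) => [|A /eqP-> //].
have := card_draws 'I_n i; rewrite card_ord => <-.
by rewrite sumr_const cardsE.
Qed.

Definition binom_mean {R : pzRingType} (p : R) (n : nat) (f : nat -> R) : R :=
  \sum_(i < n.+1) (p ^+ i * (1 - p) ^+ (n - i) * f i) *+ 'C(n, i).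

(** Conditioning on one trial: Pascal's rule splits each coefficient into a success and a failure
    share. *)
Lemma binom_meanS (R : comPzRingType) (p : R) n f :
  binom_mean p n.+1 f =
  p * binom_mean p n (fun i => f i.+1) + (1 - p) * binom_mean p n f.
Proof.
rewrite /binom_mean big_ord_recl /= !bin0 !subn0 expr0 mul1r.
under eq_bigr => i _ do rewrite /bump /= add1n binS subSS mulrnDr.
rewrite big_split /= addrA addrC; congr (_ + _).
  by rewrite mulr_sumr; apply: eq_bigr => i _; rewrite mulrnAr exprS !mulrA.
(* In the failure share the top index has coefficient ['C(n, n.+1) = 0], so the sum shortens to
   match the other side. *)
rewrite big_ord_recr /= bin_small // mulr0n addr0.
rewrite big_ord_recl /= bin0 subn0 expr0 mul1r mulrDr !mulr1n exprS mulrA.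
congr (_ + _); rewrite mulr_sumr; apply: eq_bigr => i _.
rewrite /bump /= add1n mulrnAr; congr (_ *+ _).
by rewrite -(subnSK (ltn_ord i)) [(1 - p) ^+ _.+1]exprS !mulrA [_ * p ^+ _]mulrC.
Qed.

Lemma binom_mean1 (R : comPzRingType) (p : R) n : binom_mean p n (fun=> 1) = 1.
Proof.
elim: n => [|n IHn]; last by rewrite binom_meanS IHn; ring.
by rewrite /binom_mean big_ord1 !expr0 !mul1r.
Qed.

(** The centre [c] is kept free because a success in the induction replaces it by [c - 1]; taking
    [c = n p] gives the variance. *)
Lemma binom_mean_sqr (R : comPzRingType) (p c : R) n :
  binom_mean p n (fun i => (i%:R - c) ^+ 2)
  = n%:R * p * (1 - p) + (n%:R * p - c) ^+ 2.
Proof.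
elim: n c => [|n IHn] c.
  by rewrite /binom_mean big_ord1 /= bin0 mulr1n !expr0; ring.
rewrite binom_meanS IHn.
have -> : binom_mean p n (fun i => (i.+1%:R - c) ^+ 2)
        = binom_mean p n (fun i => (i%:R - (c - 1)) ^+ 2).
  by apply: eq_bigr => i _; rewrite -natr1; congr (_ *+ _); ring.
by rewrite IHn -natr1; ring.
Qed.

Definition subset_prob {R : pzRingType} (p : R) {n : nat} (A : {set 'I_n}) : R :=
  p ^+ #|A| * (1 - p) ^+ (n - #|A|).

Lemma sum_subset_prob (R : pzRingType) (p : R) n (f : nat -> R) :
  \sum_(A : {set 'I_n}) subset_prob p A * f #|A| = binom_mean p n f.
Proof.
exact: (sum_set_card n (fun i => p ^+ i * (1 - p) ^+ (n - i) * f i)).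
Qed.

Lemma subset_prob_sum1 (R : comPzRingType) (p : R) n :
  \sum_(A : {set 'I_n}) subset_prob p A = 1.
Proof.
by rewrite -(binom_mean1 p n) -sum_subset_prob; under [RHS]eq_bigr do rewrite mulr1.
Qed.

Lemma subset_prob_ge0 (R : numDomainType) (p : R) n (A : {set 'I_n}) :
  0 <= p <= 1 -> 0 <= subset_prob p A.
Proof. by case/andP=> p0 p1; rewrite mulr_ge0 ?exprn_ge0 ?subr_ge0. Qed.

(** Rewrites the weight of the unerased set in [fail_prob] as a weight of the erasure set, with
    parameter [alpha]. *)
Lemma subset_probC (R : comPzRingType) (p : R) n (A : {set 'I_n}) :
  subset_prob p (~: A) = (1 - p) ^+ #|A| * p ^+ (n - #|A|).
Proof.
have cA : (#|~: A| + #|A| = n)%N by rewrite addnC cardsC card_ord.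
have -> : (n - #|A|)%N = #|~: A| by lia.
have -> : #|A| = (n - #|~: A|)%N by lia.
by rewrite /subset_prob mulrC.
Qed.

(* Below the threshold n(p + delta/2) the geometric bound is at most 2/(n delta);
   above it the bound 1 is dominated by the quadratic term, whose mean is the
   Chebyshev bound. *)
Lemma geometric_tail_mean (R : realFieldType) (p delta : R) (n L : nat)
    (f : {set 'I_n} -> R) :
  0 <= p <= 1 -> 0 < delta -> (0 < n)%N -> n%:R * (p + delta) <= L%:R ->
  (forall A, f A <= 1) ->
  (forall A, f A * 2%:R ^+ L <= 2%:R ^+ #|A|) ->
  \sum_A subset_prob p A * f A <= (4 / delta ^+ 2 + 2 / delta) / n%:R.
Proof.
move=> p01 d0 n0 hL f1 fL.
have nR : 0 < n%:R :> R by rewrite ltr0n.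
(* Half of the guaranteed gap [n delta] between the mean [n p] and [L]. *)
set h := n%:R * delta / 2.
have h0 : 0 < h by rewrite !mulr_gt0 // invr_gt0.
have fE A : f A <= h ^- 2 * (#|A|%:R - n%:R * p) ^+ 2 + h^-1.
  have h2 : 0 < h ^- 2 by rewrite invr_gt0 exprn_gt0.
  have hV : 0 < h^-1 by rewrite invr_gt0.
  have [hA|hA] := lerP h (#|A|%:R - n%:R * p).
    apply: le_trans (f1 A) _; rewrite -[leLHS]addr0 lerD ?(ltW hV) //.
    by rewrite mulrC ler_pdivlMr ?exprn_gt0 // mul1r ler_pXn2r ?nnegrE //; lra.
  apply: (@le_trans _ _ h^-1); last by rewrite lerDr mulr_ge0 ?sqr_ge0 // ltW.
  (* Here [#|A|] is at least [h] below [L], and [x < 2 ^ x] turns the geometric bound into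
     [h^-1]. *)
  have hLA : h <= L%:R - #|A|%:R.
    have : n%:R * delta = h + h by rewrite /h -splitr.
    move: hL; rewrite mulrDr; lra.
  have leAL : (#|A| <= L)%N by rewrite -(ler_nat R) -subr_ge0 (le_trans _ hLA) ?ltW.
  rewrite -[h^-1]mul1r ler_pdivlMr //.
  have := fL A; rewrite -{1}(subnK leAL) exprD mulrA ger_pMl ?exprn_gt0 //.
  have [fA0 _|fA0] := lerP (f A) 0.
    by rewrite (le_trans (mulr_le0_ge0 fA0 (ltW h0))).
  apply: le_trans; rewrite ler_pM2l // (le_trans hLA) // -natrB // -natrX ler_nat.
  by rewrite ltnW // ltn_expl.
apply: (@le_trans _ _ (\sum_A subset_prob p A *
   (h ^- 2 * (#|A|%:R - n%:R * p) ^+ 2 + h^-1))).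
  by apply: ler_sum => A _; rewrite ler_wpM2l ?subset_prob_ge0.
under eq_bigr => A _ do rewrite mulrDr mulrCA.
rewrite big_split /= -mulr_sumr -mulr_suml subset_prob_sum1 mul1r.
rewrite (sum_subset_prob p n (fun i => (i%:R - n%:R * p) ^+ 2)).
rewrite binom_mean_sqr subrr expr0n addr0 mulrDl.
have -> : h^-1 = 2 / delta / n%:R by rewrite /h; field; rewrite !gt_eqF.
rewrite lerD2r.
have -> : h ^- 2 * (n%:R * p * (1 - p)) = 4 / delta ^+ 2 / n%:R * (p * (1 - p)).
  by rewrite /h; field; rewrite !gt_eqF.
rewrite ger_pMr; last by rewrite !divr_gt0 // exprn_gt0.
case/andP: p01 => p0 p1; nra.
Qed.

(** * Counting matrices by kernels of additive maps *)

(** The translates of the kernel by [g i], for [i] in [D], are pairwise disjoint because [f]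
    separates them. *)
Lemma card_additive_kernel (A : finZmodType) (B : zmodType) (I : finType)
    (f : {additive A -> B}) (g : I -> A) (D : {set I}) :
  {in D &, injective (f \o g)} ->
  (#|[set a | f a == 0%R]| * #|D| <= #|A|)%N.
Proof.
move=> fg_inj; rewrite -cardsX.
rewrite -(card_in_imset (f := fun x => x.1 + g x.2)) ?max_card //.
move=> [a i] [b j] /setXP[/= + iD] /setXP[/= + jD] eq_ab.
rewrite !inE => /eqP fa /eqP fb.
have eq_ij : i = j.
  by apply: fg_inj => //=; have := congr1 f eq_ab; rewrite !raddfD fa fb !add0r.
by move: eq_ab; rewrite eq_ij => /addIr ->.
Qed.

Definition indicator (F : pzRingType) {n : nat} (A : {set 'I_n}) : 'cV[F]_n :=
  \col_i (i \in A)%:R.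

Lemma indicator_inj (F : nzRingType) n : injective (@indicator F n).
Proof.
move=> A B /matrixP eqAB; apply/setP=> i; have := eqAB i 0; rewrite !mxE.
by case: (i \in A); case: (i \in B) => //= /eqP; rewrite ?oner_eq0 // eq_sym oner_eq0.
Qed.

Lemma indicator_support n (u : 'cV['F_2]_n) :
  u = indicator _ [set i | u i 0 != 0].
Proof.
apply/matrixP=> i j; rewrite ord1 !mxE inE.
by case: (u i 0) => [[|[|]]] //= ?; apply: val_inj.
Qed.

(** With such a [w], the matrix [v *m w] sends [x] to any prescribed [v]; this supplies the
    translates in the kernel counts. *)
Lemma exists_dual_row (F : fieldType) n (x : 'cV[F]_n) :
  x != 0 -> exists w : 'rV[F]_n, w *m x = 1.
Proof.
case/matrix0Pn=> i [j]; rewrite ord1 => xi0.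
exists ((x i 0)^-1 *: delta_mx 0 i); apply/matrixP=> a b.
by rewrite !ord1 -scalemxAl -rowE !mxE mulVf.
Qed.

(** The projection [D] to the coordinates in [V] sends the translate [indicator A *m w], applied to
    [x], back to [indicator A]; the subsets [A] of [V] give [2 ^ #|V|] distinct values. *)
Lemma card_restricted_kernel n N (x : 'cV['F_2]_N) (V : {set 'I_n}) :
  x != 0 ->
  (#|[set G : 'M['F_2]_(n, N) | [forall i in V, (G *m x) i 0%R == 0%R]]| * 2 ^ #|V|
    <= 2 ^ (n * N))%N.
Proof.
move=> /exists_dual_row[w wx].
pose D := diag_mx (indicator 'F_2 V)^T.
have DE (u : 'cV['F_2]_n) i : (D *m u) i 0 = if i \in V then u i 0 else 0.
  by rewrite mul_diag_mx !mxE; case: ifP; rewrite ?mul1r ?mul0r.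
have := @card_additive_kernel _ _ _ (mulmx D \o mulmxr x)
  (fun A => indicator 'F_2 A *m w) (powerset V).
rewrite card_powerset card_mx card_Fp //.
have -> : [set G | (mulmx D \o mulmxr x) G == 0] =
   [set G : 'M['F_2]_(n, N) | [forall i in V, (G *m x) i 0 == 0]].
  apply/setP=> G; rewrite !inE /=; apply/eqP/forall_inP => [DG i iV|H].
    by have := congr1 (fun M : 'cV__ => M i 0) DG; rewrite /= DE iV [RHS]mxE => /eqP.
  by apply/matrixP=> i j; rewrite ord1 DE [RHS]mxE; case: ifP => // /H/eqP.
apply=> A B; rewrite !inE => AV BV /=.
have DI (C : {set 'I_n}) : C \subset V ->
    D *m (indicator 'F_2 C *m w *m x) = indicator 'F_2 C.
  move=> CV; rewrite -mulmxA wx mulmx1; apply/matrixP=> i j; rewrite ord1 DE.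
  by rewrite !mxE; case: ifPn => // /(contraNF (subsetP CV i)) ->.
by rewrite !DI // => /indicator_inj.
Qed.

(** Translating only the right block by [(r *m w)^T] shifts the image of [G] by [r], which ranges
    over [2 ^ l] vectors. *)
Lemma card_right_block_kernel n k l (u : 'cV['F_2]_n) :
  u != 0 ->
  (#|[set G : 'M['F_2]_(n, k + l) | (rsubmx G)^T *m u == 0%R]| * 2 ^ l
    <= 2 ^ (n * (k + l)))%N.
Proof.
move=> /exists_dual_row[w wu].
have := @card_additive_kernel _ _ _
  (mulmxr u \o trmx \o @rsubmx 'F_2 n k l)
  (fun r : 'cV['F_2]_l => row_mx 0 (r *m w)^T) [set: _].
rewrite cardsT !card_mx card_Fp // muln1; apply=> a b _ _ /=.
by rewrite !row_mxKr !trmxK -!mulmxA wu !mulmx1.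
Qed.

(** * Bad matrices for encoding and decoding *)

(** Binary vectors supported on [U] are indexed by subsets of [U], so that the union bound has at
    most [2 ^ #|U|] terms. *)
Definition encoding_bad {n : nat} (k l : nat) (U : {set 'I_n}) :
    {set 'M['F_2]_(n, k + l)} :=
  [set G | [exists A : {set 'I_n}, (A \subset U) && (A != set0)
     && ((rsubmx G)^T *m indicator 'F_2 A == 0)]].

Definition decoding_bad {n : nat} (k l : nat) (V : {set 'I_n}) :
    {set 'M['F_2]_(n, k + l)} :=
  [set G | [exists x : 'cV['F_2]_(k + l),
     (x != 0) && [forall i in V, (G *m x) i 0 == 0]]].

(** Union bound, with the denominator [a] cleared so that it stays in [nat]. *)
Lemma card_exists_le (T I : finType) (Q : pred I) (P : I -> pred T) (a b : nat) :
  (forall i, Q i -> #|[set t | P i t]| * a <= b)%N ->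
  (#|[set t | [exists i, Q i && P i t]]| * a <= #|Q| * b)%N.
Proof.
move=> PQ; rewrite -[leqRHS]sum_nat_const.
apply: (@leq_trans (\sum_(i in Q) #|[set t | P i t]| * a)%N); last first.
  by apply: leq_sum => i; apply: PQ.
rewrite -big_distrl leq_mul2r /=; apply/orP; right.
have -> : [set t | [exists i, Q i && P i t]] = \bigcup_(i in Q) [set t | P i t].
  apply/setP=> t; rewrite inE; apply/existsP/bigcupP => [[i /andP[Qi Pit]]|[i Qi]].
    by exists i => //; rewrite inE.
  by rewrite inE => Pit; exists i; apply/andP.
elim/big_rec2: _ => [|i x A _ leAx]; first by rewrite cards0.
by apply: leq_trans (leq_card_setU _ _) _; rewrite leq_add2l.
Qed.

Lemma card_encoding_bad n k l (U : {set 'I_n}) :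
  (#|encoding_bad k l U| * 2 ^ l <= 2 ^ #|U| * 2 ^ (n * (k + l)))%N.
Proof.
apply: leq_trans (card_exists_le (b := 2 ^ (n * (k + l))) _) _ => [A /andP[_ A0]|].
  apply: card_right_block_kernel; apply: contraNneq A0 => A0; apply/eqP.
  by apply: (@indicator_inj 'F_2); rewrite A0; apply/matrixP=> i j; rewrite !mxE inE.
rewrite leq_mul2r -card_powerset; apply/orP; right; apply/subset_leq_card/subsetP=> A.
by case/andP=> AU _; rewrite inE.
Qed.

Lemma card_decoding_bad n k l (V : {set 'I_n}) :
  (#|decoding_bad k l V| * 2 ^ #|V| <= 2 ^ (k + l) * 2 ^ (n * (k + l)))%N.
Proof.
apply: leq_trans (card_exists_le (b := 2 ^ (n * (k + l))) _) _ => [x|].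
  exact: card_restricted_kernel.
rewrite leq_mul2r; apply/orP; right; apply: leq_trans (max_card _) _.
by rewrite card_mx card_Fp // muln1.
Qed.

(* Fredholm alternative for the rows in U. *)
Lemma encode_d_None n k l (G : 'M['F_2]_(n, k + l)) U s m :
  encode_d G U s m = None ->
  G \in encoding_bad k l U.
Proof.
rewrite /encode_d; case: pickP => // nosol _.
apply: contraT; rewrite inE negb_exists => /forallP noA.
pose D := diag_mx (indicator 'F_2 U)^T.
have DE p (M : 'M['F_2]_(n, p)) i j : (D *m M) i j = if i \in U then M i j else 0.
  by rewrite mul_diag_mx !mxE; case: ifP; rewrite ?mul1r ?mul0r.
set G0 := rsubmx G in nosol noA; set b := lsubmx G *m m + s in nosol.
have Dt : D^T = D by rewrite tr_diag_mx.
pose K := cokermx (G0^T *m D).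
(* A nonzero column of [D *m K] would be a nonzero vector supported on [U] and killed by [G0^T],
   which [noA] excludes. *)
have DK0 : D *m K = 0.
  apply/matrixP=> i j; rewrite [RHS]mxE; apply/eqP; apply: contraT => Kij.
  pose u := D *m col j K.
  have uE a : u a 0 = (D *m K) a j by rewrite /u !DE mxE.
  have /negP[] := noA [set a | u a 0 != 0]; rewrite -indicator_support.
  rewrite -andbA; apply/and3P; split.
  - by apply/subsetP=> a; rewrite inE /u DE; case: ifP => //; rewrite eqxx.
  - by apply/set0Pn; exists i; rewrite inE uE.
  - by rewrite /u colE 2!mulmxA mulmx_coker mul0mx.
(* Since [b^T *m D] annihilates the cokernel, it lies in the row space of [G0^T *m D]; transposing
   the coefficients solves the encoding system on [U]. *)
have /submxP[d /(congr1 trmx)] : ((b^T *m D) <= G0^T *m D)%MS.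
  by rewrite submxE -/K -mulmxA DK0 mulmx0.
rewrite !trmx_mul !trmxK Dt -mulmxA => db.
have /forall_inPn[i iU /negP[]] := negbT (nosol d^T).
by have := congr1 (fun M : 'cV__ => M i 0) db; rewrite /= !DE iU => ->.
Qed.

Lemma recovery_failure_sub n k l (G : 'M['F_2]_(n, k + l)) U s V m :
  recovery_failure G U s V m ->
  (G \in encoding_bad k l U) || (G \in decoding_bad k l V).
Proof.
rewrite /recovery_failure; case E: (encode_d G U s m) => [d|]; last first.
  by rewrite (encode_d_None E).
case/orP=> [/existsP[x1 /existsP[x2 /and3P[/forall_inP s1 /forall_inP s2 neq]]]|].
  apply/orP; right; rewrite inE; apply/existsP; exists (x1 - x2); apply/andP; split.
    by apply: contraNneq neq => /subr0_eq ->.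
  apply/forall_inP=> i iV; rewrite mulmxBr mxE [X in _ + X]mxE.
  by rewrite (eqP (s1 i iV)) (eqP (s2 i iV)) subrr.
(* The pair [(m, d)] always decodes: on a defect the codeword bit is [G1 m + (G1 m + s) = s] in
   characteristic 2. *)
move: E; rewrite /encode_d; case: pickP => // d' /forall_inP dP [<-] /negP[].
apply/forall_inP=> i _; rewrite -{1}[G]hsubmxK mul_row_col.
rewrite [X in _ == X]mxE; case: ifP => // iU.
rewrite mxE (eqP (dP i iU)) [X in _ + X]mxE addrA.
by rewrite -mulr2n -mulr_natl pchar_Fp_0 // mul0r add0r.
Qed.

(** * Averaging over the channel and the limit *)

(** Each bad event depends on [G] and only one of [U] and [W], so the other variables integrate to
    1. *)
Lemma fail_prob_le (R : numFieldType) (alpha beta : R) n k l m :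
  0 <= alpha <= 1 -> 0 <= beta <= 1 ->
  fail_prob alpha beta n k l m <=
    \sum_(U : {set 'I_n}) subset_prob beta U *
       (#|encoding_bad k l U|%:R / 2 ^+ (n * (k + l)))
  + \sum_(W : {set 'I_n}) subset_prob alpha W *
       (#|decoding_bad k l (~: W)|%:R / 2 ^+ (n * (k + l))).
Proof.
move=> a01 b01; rewrite /fail_prob.
set N := (n * (k + l))%N.
have memE (T : finType) (E : {set T}) :
    #|E|%:R / 2 ^+ N = \sum_x 2^-1 ^+ N * (x \in E)%:R :> R.
  rewrite -mulr_sumr mulrC exprVn -sum1_card big_mkcond natr_sum.
  by congr (_ * _); apply: eq_bigr => x _; case: (x \in E).
have uniform_s (z : R) : z = \sum_(s : 'cV['F_2]_n) 2^-1 ^+ n * z.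
  rewrite sumr_const card_mx card_Fp // muln1 -mulrnAl -[_ *+ 2 ^ n]mulr_natr.
  by rewrite natrX -exprMn mulVf ?expr1n ?mul1r // pnatr_eq0.
apply: (@le_trans _ _ (\sum_(G : 'M['F_2]_(n, k + l)) \sum_(U : {set 'I_n})
    \sum_(W : {set 'I_n}) 2^-1 ^+ N * subset_prob beta U * subset_prob alpha W
     * ((G \in encoding_bad k l U)%:R + (G \in decoding_bad k l (~: W))%:R))).
  apply: ler_sum => G _; apply: ler_sum => U _.
  (* Passes from the unerased set [V] to the erasure set [W = ~: V]. *)
  rewrite exchange_big (reindex_inj (@setC_inj _)) /=; apply: ler_sum => W _.
  rewrite [leRHS]uniform_s; apply: ler_sum => s _.
  rewrite -subset_probC setCK -/(subset_prob beta U) -/N.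
  have swap (a b c d e : R) : a * (b * c * d * e) = b * c * a * d * e by ring.
  rewrite swap.
  have w0 : 0 <= 2^-1 ^+ N * subset_prob beta U * 2^-1 ^+ n * subset_prob alpha W.
    apply: mulr_ge0 (subset_prob_ge0 _ a01).
    apply: mulr_ge0; first apply: mulr_ge0 (subset_prob_ge0 _ b01).
      by rewrite exprn_ge0 ?invr_ge0.
    by rewrite exprn_ge0 ?invr_ge0.
  rewrite ler_wpM2l // -natrD ler_nat.
  case: (boolP (recovery_failure _ _ _ _ _)) => // /recovery_failure_sub.
  by case: (G \in _); case: (G \in _).
rewrite (eq_bigr (fun G : 'M['F_2]_(n, k + l) =>
    \sum_(U : {set 'I_n}) subset_prob beta U * (2^-1 ^+ N * (G \in encoding_bad k l U)%:R)
  + \sum_(W : {set 'I_n}) subset_prob alpha W *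
      (2^-1 ^+ N * (G \in decoding_bad k l (~: W))%:R))) => [|G _].
  rewrite big_split /= le_eqVlt; apply/orP; left; apply/eqP.
  by congr (_ + _); rewrite exchange_big; apply: eq_bigr => A _; rewrite memE mulr_sumr.
(* Multiplying each single sum by the total mass 1 of the other random set makes both terms double
   sums over [U] and [W]. *)
have insert_total (x y : R) : x + y =
    x * \sum_(W : {set 'I_n}) subset_prob alpha W
  + (\sum_(U : {set 'I_n}) subset_prob beta U) * y.
  by rewrite !subset_prob_sum1 mulr1 mul1r.
rewrite [RHS]insert_total.
rewrite !mulr_suml -big_split; apply: eq_bigr => U _ /=.
rewrite !mulr_sumr -big_split; apply: eq_bigr => W _ /=.
by move: (2^-1 ^+ N) => c; ring.
Qed.

Lemma natr_ratio_le (R : numFieldType) (x a b c : nat) :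
  (x * 2 ^ a <= 2 ^ b * 2 ^ c)%N ->
  x%:R / 2 ^+ c * 2 ^+ a <= 2 ^+ b :> R.
Proof.
by move=> le_x; rewrite mulrAC ler_pdivrMr ?exprn_gt0 // -!natrX -!natrM ler_nat.
Qed.

Lemma matrix_ratio_le1 (R : numFieldType) n k (E : {set 'M['F_2]_(n, k)}) :
  #|E|%:R / 2 ^+ (n * k) <= 1 :> R.
Proof.
rewrite ler_pdivrMr ?exprn_gt0 // mul1r -natrX ler_nat.
by apply: leq_trans (max_card _) _; rewrite card_mx card_Fp.
Qed.

Lemma encoding_mean_le (R : realFieldType) (beta delta : R) n k l :
  0 <= beta <= 1 -> 0 < delta -> (0 < n)%N -> beta + delta <= l%:R / n%:R ->
  \sum_(U : {set 'I_n}) subset_prob beta U *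
    (#|encoding_bad k l U|%:R / 2 ^+ (n * (k + l)))
  <= (4 / delta ^+ 2 + 2 / delta) / n%:R.
Proof.
move=> b01 d0 n0; rewrite ler_pdivlMr ?ltr0n // mulrC => le_l.
apply: geometric_tail_mean le_l _ _ => // U; first exact: matrix_ratio_le1.
exact/natr_ratio_le/card_encoding_bad.
Qed.

Lemma decoding_mean_le (R : realFieldType) (alpha delta : R) n k l :
  0 <= alpha <= 1 -> 0 < delta -> (0 < n)%N ->
  (k + l)%:R / n%:R <= 1 - alpha - delta ->
  \sum_(W : {set 'I_n}) subset_prob alpha W *
    (#|decoding_bad k l (~: W)|%:R / 2 ^+ (n * (k + l)))
  <= (4 / delta ^+ 2 + 2 / delta) / n%:R.
Proof.
move=> a01 d0 n0; rewrite ler_pdivrMr ?ltr0n // => le_kl.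
have nR : 0 < n%:R :> R by rewrite ltr0n.
(* Ensures that the threshold [n - (k + l)] is not a truncated subtraction. *)
have kl_n : (k + l <= n)%N.
  rewrite -(ler_nat R); apply: le_trans le_kl _.
  by rewrite ger_pMl //; case/andP: a01 => a0 _; lra.
apply: (@geometric_tail_mean _ _ _ _ (n - (k + l))) => // [|W|W].
- rewrite natrB // mulrDr; move: le_kl; rewrite !mulrBl mul1r.
  rewrite [alpha * _]mulrC [delta * _]mulrC; lra.
- exact: matrix_ratio_le1.
(* After clearing both powers of 2, the exponents agree because [#|W| + #|~: W| = n]. *)
apply: natr_ratio_le; rewrite -(leq_pmul2r (expn_gt0 2 #|~: W|)).
have cW : (#|W| + #|~: W| = n)%N by rewrite cardsC card_ord.
have := card_decoding_bad k l (~: W); rewrite -(leq_pmul2r (expn_gt0 2 (n - (k + l)))).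
rewrite mulnAC => /leq_trans; apply.
by rewrite -!expnD leq_exp2l //; lia.
Qed.

Theorem theorem3 (R : archiRealFieldType) (alpha beta : R) (k l : nat -> nat)
  (m : forall n : nat, 'cV['F_2]_(k n)) :
  0 <= alpha < 1 -> 0 <= beta < 1 -> alpha + beta < 1 ->
  (exists2 delta : R, 0 < delta &
     exists N : nat, forall n : nat, (N <= n)%N -> beta + delta <= (l n)%:R / n%:R) ->
  (exists2 delta : R, 0 < delta &
     exists N : nat, forall n : nat, (N <= n)%N ->
       (k n + l n)%:R / n%:R <= 1 - alpha - delta) ->
  forall eps : R, 0 < eps ->
    exists N : nat, forall n : nat, (N <= n)%N ->
      fail_prob alpha beta n (k n) (l n) (m n) <= eps.
Proof.
move=> /andP[a0 a1] /andP[b0 b1] _ [d1 d1_gt0 [N1 hN1]] [d2 d2_gt0 [N2 hN2]] eps e0.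
have a01 : 0 <= alpha <= 1 by rewrite a0 ltW.
have b01 : 0 <= beta <= 1 by rewrite b0 ltW.
pose C := (4 / d1 ^+ 2 + 2 / d1) + (4 / d2 ^+ 2 + 2 / d2).
have C0 : 0 <= C.
  by rewrite !addr_ge0 // ?divr_ge0 // ltW // exprn_gt0.
(* Beyond [C / eps] the bound [C / n] is at most [eps]; the successor also forces [n > 0]. *)
exists (maxn (maxn N1 N2) (Num.bound (C / eps)).+1) => n.
rewrite !geq_max -andbA => /and3P[n1 n2 n3].
have n0 : (0 < n)%N by apply: leq_trans n3.
apply: le_trans (fail_prob_le _ _ _ a01 b01) _.
apply: le_trans (lerD (encoding_mean_le _ b01 d1_gt0 n0 (hN1 n n1))
                      (decoding_mean_le a01 d2_gt0 n0 (hN2 n n2))) _.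
rewrite -mulrDl -/C ler_pdivrMr ?ltr0n // mulrC -ler_pdivrMr //.
apply: le_trans (ltW (archi_boundP _)) _; first by rewrite divr_ge0 // ltW.
by rewrite ler_nat ltnW.
Qed.
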